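(* Let $q\in(0,1)$ and $r=1-q$, and consider the random graph process $\mathcal{I}_{2V}$ with parameters $q,r$. For all integers $t\ge 0$ and $n\ge 0$, the probability $p_t(n)$ that the graph has exactly $n$ vertices at step $t$ is $$p_t(n)=\begin{cases}\displaystyle\binom{t}{t-n+3}r^{n-3}q^{t-n+3} & n>2,\\ 0 & n\in\{0,1,2\}.\end{cases}$$
   Context: The probabilistic inductive class $\mathcal{I}_{2V}$ (2-vertex-connected graphs, multiple edges allowed, no loops) is the following random graph process. At step $0$ the graph is a triangle ($3$ vertices, $3$ edges). At each step one rule is chosen and applied, independently of the past: rule R2 with probability $q$, rule R3 with probability $r=1-q$. R2: choose two different vertices uniformly at random (possibly already adjacent) and add one edge joining them. R3: choose an edge uniformly at random and expand it with a vertex and another edge, i.e. subdivide it by one new vertex (adding one vertex and increasing the number of edges by one). Convention: $\binom{a}{b}=0$ if $b<0$ or $b>a$. *)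

(* Defs.v *)
From HB Require Import structures.
From mathcomp Require Import all_boot all_order all_algebra.
From mathcomp Require Import all_classical all_reals all_analysis.

Set Implicit Arguments.
Unset Strict Implicit.
Unset Printing Implicit Defensive.

Import Order.TTheory GRing.Theory Num.Theory.

Local Open Scope classical_set_scope.
Local Open Scope ring_scope.

(* An edge on the vertex set 'I_n has two distinct ends, so there are no loops. *)
Definition edge (n : nat) := {e : {set 'I_n} | #|e| == 2%N}.

(* The vertices are 'I_n.  Listing the edges (with possible repetitions) gives
   each parallel edge its own identity: the edges of g are the positions
   'I_(size (edges g)). *)
Definition multigraph := {n : nat & seq (edge n)}.

Definition nvertices (g : multigraph) : nat := tag g.
Definition edges (g : multigraph) : seq (edge (nvertices g)) := tagged g.
Definition nedges (g : multigraph) : nat := size (edges g).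

(* The three 2-subsets of 'I_3, each once. *)
Definition triangle : multigraph := existT _ 3 (enum {: edge 3}).

Definition add_edge (g : multigraph) (e : edge (nvertices g)) : multigraph :=
  existT _ (nvertices g) (rcons (edges g) e).

(* The vertices of 'I_n keep their numbers in 'I_n.+1; the new vertex is
   ord_max. *)
Lemma old_edge_subproof (n : nat) (e : edge n) :
  #|[set lift ord_max x | x in val e]%SET| == 2%N.
Proof. by rewrite card_imset ?(valP e) //; exact: lift_inj. Qed.

Definition old_edge (n : nat) (e : edge n) : edge n.+1 :=
  exist (fun e : {set 'I_n.+1} => #|e| == 2%N) _ (old_edge_subproof e).

Lemma new_edge_subproof (n : nat) (x : 'I_n) :
  #|[set lift ord_max x; ord_max]%SET| == 2%N.
Proof. by rewrite cards2 (eq_sym (lift _ _)) neq_lift. Qed.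

Definition new_edge (n : nat) (x : 'I_n) : edge n.+1 :=
  exist (fun e : {set 'I_n.+1} => #|e| == 2%N) _ (new_edge_subproof x).

(* The edge {u, v} in position i is removed and replaced by the two edges
   {u, w} and {v, w}, where w is the new vertex. *)
Definition subdivide (g : multigraph) (i : 'I_(nedges g)) : multigraph :=
  let e := tnth (in_tuple (edges g)) i in
  existT _ (nvertices g).+1
    (map (@old_edge _) (take i (edges g) ++ drop i.+1 (edges g))
     ++ [seq new_edge x | x <- enum (val e)]).

Inductive rule := R2 | R3.

Definition rule_prob (R : realType) (q r : R) (a : rule) : R :=
  match a with R2 => q | R3 => r end.

(* Probability that rule a turns g into g': the proportion of favourable
   2-subsets of the vertices (R2) or edges (R3), chosen uniformly. *)
Definition step_prob (R : realType) (a : rule) (g g' : multigraph) : R :=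
  match a with
  | R2 => #|[pred e : edge (nvertices g) | add_edge e == g']|%:R
          / #|{: edge (nvertices g)}|%:R
  | R3 => #|[pred i : 'I_(nedges g) | subdivide i == g']|%:R
          / (nedges g)%:R
  end.

(* The past at step t: the graphs at steps 0, ..., t are h 0, ..., h t, and the
   rules applied from these to the next ones before step t are
   a 0, ..., a (t - 1). *)
Definition past (Omega : Type) (G : nat -> Omega -> multigraph)
    (A : nat -> Omega -> rule) (t : nat) (h : nat -> multigraph)
    (a : nat -> rule) : set Omega :=
  [set w | (forall s, (s <= t)%N -> G s w = h s) /\
           (forall s, (s < t)%N -> A s w = a s)].

(* G t is the graph at step t and A t the rule that leads from G t to G t.+1.
   The last two fields are the conditional probabilities
     P (A t = b | past) = rule_prob b  and
     P (G t.+1 = g' | past, A t = b) = step_prob b (G t) g',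
   multiplied out so that they also make sense for null events. *)
Record I2V_process (d : measure_display) (Omega : measurableType d)
    (R : realType) (P : probability Omega R) (q r : R)
    (G : nat -> Omega -> multigraph) (A : nat -> Omega -> rule) : Prop := {
  I2V_measurable_graph : forall t g, measurable [set w | G t w = g];
  I2V_measurable_rule : forall t b, measurable [set w | A t w = b];
  I2V_start : P [set w | G 0%N w = triangle] = 1%E;
  I2V_rule : forall t h a b,
    (P (past G A t h a `&` [set w | A t w = b])
     = P (past G A t h a) * (rule_prob q r b)%:E)%E;
  I2V_step : forall t h a b g',
    (P (past G A t h a `&` [set w | A t w = b] `&` [set w | G t.+1 w = g'])
     = P (past G A t h a `&` [set w | A t w = b])
       * (step_prob R b (h t) g')%:E)%E
}.

(* 'C(a, b) already vanishes for b > a; this extends it by 0 to negative b. *)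
Definition binz (a : nat) (b : int) : nat :=
  if b is Posz k then 'C(a, k) else 0%N.

(* Main.v *)
(* A step adds a vertex exactly when its rule is R3, and the rule is independent
   of the past, so the number of vertices beyond the initial three is a binomial
   variable; Pascal's rule is its recursion in t.  Independence is only given on
   the events fixing the whole past, but the past takes countably many values,
   so it extends by countable additivity to every event on the number of
   vertices at step t.  In the same way, the steps that change the number of
   vertices against their rule form a null event. *)

Require Import Defs.
From HB Require Import structures.
From mathcomp Require Import all_boot all_order all_algebra.
From mathcomp Require Import all_classical all_reals all_analysis.
From mathcomp Require Import ring.

Set Implicit Arguments.
Unset Strict Implicit.
Unset Printing Implicit Defensive.

Import Order.TTheory GRing.Theory Num.Theory.

Local Open Scope classical_set_scope.
Local Open Scope ring_scope.

(** * Measures of preimages under maps with countably many values *)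

Section CountableFibers.
Context (d : measure_display) (Omega : measurableType d) (T : countType).
Variable X : Omega -> T.
Hypothesis measurable_fiber : forall x, measurable [set w | X w = x].

(** Indexing the fibers of [X] over [S] by the codes [pickle] gives a disjoint union over [nat], as
    countable additivity requires; a code not attained in [S] gives the empty set. *)
Let piece (S : set T) (k : nat) : set Omega :=
  [set w | pickle (X w) = k /\ S (X w)].

Let preimage_pieces (S : set T) : X @^-1` S = \bigcup_k piece S k.
Proof.
apply/seteqP; split=> [w Sw|w [k _ [_]]] //.
by exists (pickle (X w)).
Qed.

Let pieceE (S : set T) (k : nat) :
  piece S k = set0 \/
  exists w0, S (X w0) /\ piece S k = [set w | X w = X w0].
Proof.
have [[w0 [<- Sw0]]|no_w] := pselect (exists w, piece S k w).
  right; exists w0; split=> //; apply/seteqP; split=> [w [Xw _]|w /= Xw].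
    exact: (pcan_inj pickleK).
  by rewrite /piece /= Xw.
by left; apply/seteqP; split=> [w Sw|//]; apply: no_w; exists w.
Qed.

Let measurable_piece (S : set T) (k : nat) : measurable (piece S k).
Proof. by have [->|[w0 [_ ->]]] := pieceE S k. Qed.

Lemma measurable_countable_preimage (S : set T) : measurable (X @^-1` S).
Proof.
rewrite preimage_pieces; apply: bigcup_measurable => k _.
exact: measurable_piece.
Qed.

(** The factor [c] is the same on all fibers over [S], so it comes out of the series that sums their
    measures. *)
Lemma measure_countable_preimage (R : realType)
    (mu : {measure set Omega -> \bar R}) (S : set T) (B : set Omega) (c : R) :
  measurable B ->
  (forall w, S (X w) ->
    mu ([set w' | X w' = X w] `&` B) =
    (c%:E * mu [set w' | X w' = X w])%E) ->
  mu (X @^-1` S `&` B) = (c%:E * mu (X @^-1` S))%E.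
Proof.
move=> mB fiberB.
have tI : trivIset setT (piece S).
  by move=> i j _ _ [w [[<- _] [<- _]]].
rewrite preimage_pieces setI_bigcupl !measure_semi_bigcup //; first last.
- by apply: bigcup_measurable => k _; apply: measurableI.
- by move=> i j _ _ [w [[[<- _] _] [[<- _] _]]].
- by move=> k; apply: measurableI.
- by apply: bigcup_measurable => k _.
rewrite -nneseriesZl //; apply: eq_eseriesr => k _.
have [->|[w0 [Sw0 ->]]] := pieceE S k; last exact: fiberB.
by rewrite set0I measure0 mule0.
Qed.

End CountableFibers.

(** Adjoining [N] changes neither measure and makes the two events equal. *)
Lemma eq_measure_mod_null (d : measure_display) (Omega : measurableType d)
    (R : realType) (mu : {measure set Omega -> \bar R}) (E F N : set Omega) :
  measurable E -> measurable F -> measurable N -> mu N = 0%E ->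
  (forall w, ~ N w -> E w <-> F w) -> mu E = mu F.
Proof.
move=> mE mF mN N0 EF; rewrite -(measureU0 mE mN N0) -(measureU0 mF mN N0).
congr (mu _); apply/seteqP; split=> w;
  by have [Nw|/EF EFw] := pselect (N w); [right|case=> [/EFw|]; [left|right]].
Qed.

(** * Histories of the process and the events they determine *)

Definition is_R3 (a : rule) : bool := if a is R3 then true else false.

Lemma is_R3_inj : injective is_R3.
Proof. by case=> [] []. Qed.

Lemma step_prob_eq0 (R : realType) (a : rule) (g g' : multigraph) :
  nvertices g' <> (nvertices g + is_R3 a)%N -> step_prob R a g g' = 0.
Proof.
case: a => /= nv; rewrite eq_card0 ?mul0r // => x; apply/negbTE/negP => /eqP g'E;
  by apply: nv; rewrite -g'E ?addn0 ?addn1.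
Qed.

Section History.
Context (d : measure_display) (Omega : measurableType d) (R : realType).
Variables (P : probability Omega R) (q r : R).
Variables (G : nat -> Omega -> multigraph) (A : nat -> Omega -> rule).
Hypothesis GA_process : I2V_process P q r G A.

Let measurable_graph := I2V_measurable_graph GA_process.
Let measurable_rule := I2V_measurable_rule GA_process.

(** The past in the form of finite lists, which range over a countable type; rules enter as booleans
    for this reason. There is one graph more than there are rules. *)
Definition history (t : nat) (w : Omega) : seq multigraph * seq bool :=
  ([seq G s w | s <- iota 0 t.+1], [seq is_R3 (A s w) | s <- iota 0 t]).

Lemma history_past (t : nat) (w0 : Omega) :
  [set w | history t w = history t w0] = past G A t (G ^~ w0) (A ^~ w0).
Proof.
apply/seteqP; split=> w.
  move=> /= wE; have /eq_in_map GE := congr1 fst wE.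
  have /eq_in_map AE := congr1 snd wE; split=> s st.
    by apply: GE; rewrite mem_iota.
  by apply: is_R3_inj; apply: AE; rewrite mem_iota.
case=> GE AE; congr pair; apply/eq_in_map => s; rewrite mem_iota /= add0n => st.
  exact: GE.
by rewrite AE.
Qed.

Lemma nth_history_graph (s t : nat) (w : Omega) :
  (s <= t)%N -> nth triangle (history t w).1 s = G s w.
Proof. by move=> st; rewrite (nth_map 0%N) ?size_iota // nth_iota. Qed.

Lemma nth_history_rule (s t : nat) (w : Omega) :
  (s < t)%N -> nth false (history t w).2 s = is_R3 (A s w).
Proof. by move=> st; rewrite (nth_map 0%N) ?size_iota // nth_iota. Qed.

Lemma measurable_history (t : nat) (x : seq multigraph * seq bool) :
  measurable [set w | history t w = x].
Proof.
have [[w0 <-]|no_w] := pselect (exists w, history t w = x); last first.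
  suff -> : [set w | history t w = x] = set0 by [].
  by apply/seteqP; split=> [w xw|//]; apply: no_w; exists w.
rewrite history_past.
have -> : past G A t (G ^~ w0) (A ^~ w0) =
    \bigcap_(s in [set s | (s <= t)%N]) [set w | G s w = G s w0] `&`
    \bigcap_(s in [set s | (s < t)%N]) [set w | A s w = A s w0] by [].
by apply: measurableI; apply: bigcap_measurableType => s _.
Qed.

Lemma measurable_nvertices (t : nat) (S : set nat) :
  measurable [set w | S (nvertices (G t w))].
Proof.
exact: (measurable_countable_preimage (X := G t) (measurable_graph t)
  [set g | S (nvertices g)]).
Qed.

(** The vertex count at step [t] is a function of the history, and on each history the next rule
    contributes the same factor. *)
Lemma nvertices_rule_indep (t : nat) (S : set nat) (a : rule) :
  P ([set w | S (nvertices (G t w))] `&` [set w | A t w = a]) =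
  ((rule_prob q r a)%:E * P [set w | S (nvertices (G t w))])%E.
Proof.
pose SH : set (seq multigraph * seq bool) :=
  [set x | S (nvertices (nth triangle x.1 t))].
have -> : [set w | S (nvertices (G t w))] = history t @^-1` SH.
  by apply/seteqP; split=> w; rewrite /preimage /SH /= nth_history_graph.
apply: measure_countable_preimage => //; first exact: measurable_history.
by move=> w _; rewrite history_past muleC; exact: (I2V_rule GA_process).
Qed.

Definition irregular (t : nat) : set Omega :=
  [set w | nvertices (G t.+1 w) <> (nvertices (G t w) + is_R3 (A t w))%N].

Let irregular_history (t : nat) : irregular t =
  history t.+1 @^-1` [set x | nvertices (nth triangle x.1 t.+1) <>
    (nvertices (nth triangle x.1 t) + nth false x.2 t)%N].
Proof.
by apply/seteqP; split=> w; rewrite /preimage /irregular /mkset;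
  rewrite !nth_history_graph ?nth_history_rule.
Qed.

Lemma measurable_irregular (t : nat) : measurable (irregular t).
Proof.
rewrite irregular_history; apply: measurable_countable_preimage.
exact: measurable_history.
Qed.

Lemma irregular_null (t : nat) : P (irregular t) = 0%E.
Proof.
(* With [setT] as second event and factor 0, it suffices that each single irregular history is
   null. *)
rewrite irregular_history -[X in P X]setIT.
rewrite (@measure_countable_preimage _ _ _ _ (measurable_history t.+1)
  _ P _ _ 0) ?mul0e //.
move=> w; rewrite setIT mul0e history_past /mkset.
rewrite !nth_history_graph // nth_history_rule //.
move=> irr; set g := G t.+1 w in irr; set a := A t w in irr.
(* The history up to [t.+1] lies in the event that fixes the past at [t], the rule [a] and the next
   graph [g], a transition of probability 0. *)
apply: (@subset_measure0 _ _ _ P _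
  (past G A t (G ^~ w) (A ^~ w) `&` [set w' | A t w' = a]
   `&` [set w' | G t.+1 w' = g])).
- by rewrite -history_past; exact: measurable_history.
- by rewrite -history_past; do 2?apply: measurableI => //; exact: measurable_history.
- move=> w' [GE AE]; split; last exact: GE.
  by split; [split=> s st; [apply: GE|apply: AE]; exact: leqW|exact: AE].
etransitivity; first exact: (I2V_step GA_process).
by rewrite step_prob_eq0 ?mule0.
Qed.

(** * The distribution of the number of vertices *)

Lemma nvertices_recursion (t : nat) (S : set nat) :
  P [set w | S (nvertices (G t.+1 w))] =
  (q%:E * P [set w | S (nvertices (G t w))] +
   r%:E * P [set w | S (nvertices (G t w)).+1])%E.
Proof.
pose E2 := [set w | S (nvertices (G t w))] `&` [set w | A t w = R2].
pose E3 := [set w | S (nvertices (G t w)).+1] `&` [set w | A t w = R3].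
have mE2 : measurable E2 by apply: measurableI => //; exact: measurable_nvertices.
have mE3 : measurable E3.
  by apply: measurableI => //; exact: (measurable_nvertices t (fun n => S n.+1)).
(* Off the irregular event, R2 keeps the vertex count and R3 raises it by one; [E2] and [E3] are
   disjoint, as their rules differ. *)
transitivity (P (E2 `|` E3)).
  apply: (@eq_measure_mod_null _ _ _ _ _ _ (irregular t)).
  - exact: measurable_nvertices.
  - exact: measurableU.
  - exact: measurable_irregular.
  - exact: irregular_null.
  move=> w /contrapT; rewrite /E2 /E3 /setU /setI /mkset => ->.
  case: (A t w) => /=; rewrite ?addn0 ?addn1;
    split=> [Sw|[[]|[]]] //; first [by left | by right].
have -> : P (E2 `|` E3) = (P E2 + P E3)%E.
  apply: measureU => //.
  by apply/seteqP; split=> [w [[_ ARw] [_]]|//]; rewrite /= ARw.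
by rewrite nvertices_rule_indep (nvertices_rule_indep t (fun n => S n.+1)).
Qed.

(** The initial graph is the triangle only almost surely, hence the passage through a null event. *)
Lemma nvertices_start (n : nat) :
  P [set w | nvertices (G 0%N w) = n] = (n == 3)%:R%:E.
Proof.
have m0 := measurable_graph 0 triangle.
have N0 : P (~` [set w | G 0%N w = triangle]) = 0%E.
  by rewrite probability_setC // (I2V_start GA_process) subee.
have [->|/eqP n3] := eqVneq n 3.
  rewrite -[RHS](@probability_setT _ _ _ P).
  apply: (eq_measure_mod_null _ _ (measurableC m0) N0) => //.
    exact: (measurable_nvertices 0 [set 3]).
  by move=> w /contrapT /= ->.
apply: (subset_measure0 _ (measurableC m0) _ N0).
  exact: (measurable_nvertices 0 [set n]).
by move=> w /= nw G0; apply: n3; rewrite -nw G0.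
Qed.

Lemma nvertices_small (t n : nat) :
  (n < 3)%N -> P [set w | nvertices (G t w) = n] = 0%E.
Proof.
elim: t n => [|t IHt] n n3; first by rewrite nvertices_start ltn_eqF.
rewrite (nvertices_recursion t [set n]) IHt // mule0 add0e.
case: n n3 => [|n] n3.
  by rewrite [X in P X](_ : _ = set0) ?measure0 ?mule0 //; apply/seteqP; split.
rewrite [X in P X](_ : _ = [set w | nvertices (G t w) = n]) ?IHt ?mule0 //.
  exact: ltnW.
by apply/seteqP; split=> w /= [->].
Qed.

Lemma nvertices_binomial (t k : nat) :
  P [set w | nvertices (G t w) = (k + 3)%N] =
  ('C(t, k)%:R * r ^+ k * q ^+ (t - k))%:E.
Proof.
elim: t k => [|t IHt] k.
  rewrite nvertices_start (eqn_add2r 3 k 0) bin0n.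
  by case: k => [|k]; rewrite ?mulr1 ?mul0r.
rewrite (nvertices_recursion t [set (k + 3)%N]) IHt.
(* For [k = 0] an R3 step would have to start from two vertices, which is a null event. *)
case: k => [|k].
  have -> : [set w | [set (0 + 3)%N] (nvertices (G t w)).+1] =
      [set w | nvertices (G t w) = 2%N].
    by apply/seteqP; split=> w /= => [[]|->].
  rewrite nvertices_small // mule0 adde0 -EFinM !bin0 !subn0 exprS.
  by congr EFin; ring.
have -> : [set w | [set (k.+1 + 3)%N] (nvertices (G t w)).+1] =
    [set w | nvertices (G t w) = (k + 3)%N].
  by apply/seteqP; split=> w /= => [[]|->].
rewrite IHt -!EFinM -EFinD binS subSS natrD; congr EFin.
(* If [t <= k], the truncated exponent [t - k.+1] is harmless since ['C(t, k.+1)] vanishes;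
   otherwise [t - k] is its successor and Pascal's rule applies. *)
have [tk|kt] := leqP t k.
  by rewrite bin_small // exprS; ring.
by rewrite -(subnSK kt) !exprS; ring.
Qed.

End History.

Theorem lemma6p2 (d : measure_display) (Omega : measurableType d)
    (R : realType) (P : probability Omega R) (q r : R)
    (q_gt0 : 0 < q) (q_lt1 : q < 1) (r_def : r = 1 - q)
    (G : nat -> Omega -> multigraph) (A : nat -> Omega -> rule)
    (GA_process : I2V_process P q r G A) (t n : nat) :
  P [set w | nvertices (G t w) = n] =
    (if (2 < n)%N then
       (binz t (t%:Z - n%:Z + 3))%:R * r ^ (n%:Z - 3) * q ^ (t%:Z - n%:Z + 3)
     else 0)%:E.
Proof.
case: ltnP => n3; last exact: (nvertices_small GA_process).
have [k ->] : exists k, n = (k + 3)%N by exists (n - 3)%N; rewrite subnK.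
rewrite (nvertices_binomial GA_process); congr EFin.
have -> : t%:Z - (k + 3)%N%:Z + 3 = t%:Z - k%:Z by rewrite PoszD; ring.
have -> : (k + 3)%N%:Z - 3 = k%:Z by rewrite PoszD addrK.
(* For [k <= t] the symmetry of binomial coefficients applies; for [k > t] both coefficients vanish,
   whatever the negative power of [q]. *)
have [kt|tk] := leqP k t.
  by rewrite subzn //= bin_sub.
have : t%:Z - k%:Z < 0 by rewrite subr_lt0 ltz_nat.
by case: (t%:Z - k%:Z) => // m _; rewrite bin_small // !mul0r.
Qed.
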